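(* Let $d\ge 2$ be an integer and let $\alpha>0$ be real. Then for every $\theta=(\theta_1,\dots,\theta_d)\in\mathbb{R}^d$ such that $\theta_j\notin 2\pi\mathbb{Z}$ for all $j$, \begin{align*} F_d(\theta)={}&2\sum_{m\in\mathscr{O}_d}\ \sum_{\{j_k\}\in\mathscr{J}_m}\zeta(m+\alpha)\Bigl(2^{d-m}-\Bigl(\theta_{j_{m+1}}\cot\frac{\theta_{j_{m+1}}}{2}\Bigr)\cdots\Bigl(\theta_{j_d}\cot\frac{\theta_{j_d}}{2}\Bigr)\Bigr)\\ &+\frac{1}{2^{d-1}}\sum_{m\in\mathscr{O}_d}\ \sum_{\{j_k\}\in\mathscr{J}_m}\biggl(\cot\frac{\theta_{j_{m+1}}}{2}\cdots\cot\frac{\theta_{j_d}}{2}\\ &\quad\times\sum_{\{s_k\}\in\mathscr{U}_m}\int_{-\theta_{j_d}}^{\theta_{j_d}}\cdots\int_{-\theta_{j_{m+1}}}^{\theta_{j_{m+1}}}H_{m+\alpha-1}(s_1\theta_{j_1}+\cdots+s_m\theta_{j_m}+\eta_{m+1}+\cdots+\eta_d)\,d\eta_{m+1}\ldots d\eta_d\biggr), \end{align*} where $\zeta(s)=\sum_{n=1}^\infty n^{-s}$ is the Riemann zeta function.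
   Context: $F_d(\theta):=\sum_{z\in\mathbb{Z}^d\setminus\{0\}}\frac{1}{\|z\|^{d+\alpha}}(1-\cos\langle z,\theta\rangle)$ for $\theta\in\mathbb{R}^d$, where $\langle\cdot,\cdot\rangle$ is the standard inner product and $\|x\|=\max_i|x_i|$ is the max-norm. For $\beta>0$, $H_\beta(t):=\sum_{n=1}^\infty\frac{1}{n^{1+\beta}}(1-\cos nt)$, $t\in\mathbb{R}$. For $m=1,\dots,d$, $\mathscr{J}_m$ is the set of all sequences $\{j_1,\dots,j_d\}$ with pairwise distinct elements $j_k\in\{1,\dots,d\}$ such that $j_1\le\dots\le j_m$ and $j_{m+1}\le\dots\le j_d$ (for $m=d$ the sequence $\{j_{m+1},\dots,j_d\}$ is empty). $\mathscr{U}_m$ is the set of all sequences $\{s_1,\dots,s_m\}$ with $s_i=\pm1$. $\mathscr{O}_d$ is the set of all odd natural numbers not exceeding $d$. For $m=d$, empty products equal $1$ and there is no integration (the multiple integral is just the value of the integrand). Integrals are oriented: $\int_{-a}^{a}$ with $a<0$ equals $-\int_{a}^{-a}$. *)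

(* Defs.v *)
From HB Require Import structures.
From mathcomp Require Import all_boot all_order all_algebra.
From mathcomp Require Import all_classical all_reals all_analysis.

Set Implicit Arguments.
Unset Strict Implicit.
Unset Printing Implicit Defensive.

Import Order.TTheory GRing.Theory Num.Theory.
Import numFieldNormedType.Exports.

Local Open Scope classical_set_scope.
Local Open Scope ring_scope.

(* The sum has nonnegative terms, so it is taken over the countable index set
   in [0, +oo], with no choice of enumeration. The norm on 'rV[R]_d is the
   library's matrix norm, i.e. the max-norm. *)
Definition Fsum (R : realType) (d : nat) (alpha : R) (theta : 'rV[R]_d)
    : \bar R :=
  let real_vec (z : 'rV[int]_d) : 'rV[R]_d := map_mx intr z in
  \esum_(z in [set z : 'rV[int]_d | z != 0])
    ((`|real_vec z| `^ (d%:R + alpha))^-1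
     * (1 - cos (\sum_(i < d) (z 0 i)%:~R * theta 0 i)))%:E.

(* Meaningful for 0 < beta, where the series converges. *)
Definition H (R : realType) (beta t : R) : R :=
  limn (fun N => \sum_(1 <= n < N) (n%:R `^ (1 + beta))^-1 * (1 - cos (n%:R * t))).

(* Meaningful for 1 < s, where the series converges. *)
Definition zeta (R : realType) (s : R) : R :=
  limn (fun N => \sum_(1 <= n < N) n%:R `^ (- s)).

Definition cot (R : realType) (x : R) : R := cos x / sin x.

Definition oriented_integral (R : realType) (a b : R) (f : R -> R) : R :=
  if a <= b then \int[lebesgue_measure]_(x in `[a, b]) f x
  else - \int[lebesgue_measure]_(x in `[b, a]) f x.

(* For bs = [:: b_1; ...; b_p], the iterated integral
   \int_{-b_p}^{b_p} ... \int_{-b_1}^{b_1} f [:: e_1; ...; e_p] de_1 ... de_p :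
   the head of the list is the innermost variable. *)
Fixpoint iterated_integral (R : realType) (bs : seq R) (f : seq R -> R) : R :=
  if bs is b :: bs' then
    iterated_integral bs'
      (fun es => oriented_integral (- b) b (fun e => f (e :: es)))
  else f [::].

(* Indices are 0-based: {1, ..., d} is 'I_d, so that [take m j] is
   j_1, ..., j_m and [drop m j] is j_{m+1}, ..., j_d. *)
Definition Jset (d m : nat) : pred (d.-tuple 'I_d) := fun j =>
  [&& uniq j,
      sorted leq [seq val i | i <- take m j]
    & sorted leq [seq val i | i <- drop m j]].

(* s_1 theta_{j_1} + ... + s_m theta_{j_m}, where a sign sequence is encoded by
   Booleans, s_k being (-1) ^+ s k. *)
Definition signed_sum (R : realType) (d : nat) (theta : 'rV[R]_d)
    (m : 'I_d.+1) (j : d.-tuple 'I_d) (s : {ffun 'I_m -> bool}) : R :=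
  \sum_(k < m) (-1) ^+ s k * theta 0 (tnth j (widen_ord (leq_ord m) k)).

(* Main.v *)
Require Import Defs.
From HB Require Import structures.
From mathcomp Require Import all_boot all_order all_algebra complex ring lra zify.
From mathcomp Require Import all_classical all_reals all_analysis measurable_realfun.

Set Implicit Arguments.
Unset Strict Implicit.
Unset Printing Implicit Defensive.

Import Order.TTheory GRing.Theory Num.Theory.
Import numFieldNormedType.Exports.

Local Open Scope classical_set_scope.
Local Open Scope ring_scope.

(** Grouping the lattice points by their max-norm [n] turns [F] into the series
    over [n >= 1] of [n ^ -(d + alpha)] times the sum of [1 - cos <z, theta>]
    over the sphere of radius [n].  That sphere is the cube of radius [n] minus
    its interior, and over a cube the sum of [cos <z, theta>] factors into
    one-dimensional Dirichlet kernels.  With [c_i = cos (n theta_i)] and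
    [S_i = sin (n theta_i) cot (theta_i / 2)] the full kernel is [S_i + c_i],
    and without its two extreme frequencies it is [S_i - c_i]
    ([Dirichlet_kernel], [sum_cos_shell]).  The difference
    [prod (S_i + c_i) - prod (S_i - c_i)] is twice the sum, over the sets [A] of
    odd size, of the product of the [c_i] inside [A] and of the [S_i] outside
    ([prodD_sub_prodB]); a pair [(m, j)] with [Jset m j] is the same thing as a
    set [A] of size [m] ([JsetP]).  At [theta = 0], where the kernel is
    [2 n + 1], the same identity counts the points of the sphere ([sum_shell]).

    It remains to sum over [n] for each fixed [(m, j)].  Integrating
    [cos (n (x + e))] over [e] from [-b] to [b] gives [2 sin (n b) / n] times
    [cos (n x)].  Since [H (s - 1) t] is [zeta s] minus the series of
    [n ^ -s cos (n t)] ([H_eq_zeta_sub_cos_series]), the iterated integral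
    equals [zeta (m + alpha)] times the product of the [2 theta_i], minus the
    cosine series whose coefficients have acquired the factors
    [2 sin (n theta_i) / n] ([iterated_integral_cos_series]).  The sum over the
    signs then restores the product of the [c_i] ([sum_cos_signed]), the powers
    of [n] combine to [n ^ -(d + alpha)], and the product of the [2 theta_i]
    cancels the products of the [theta_i cot (theta_i / 2)]
    ([Jset_term_sums_to]). *)

(** * Series indexed by the positive integers *)

Definition sums_to (R : realType) (a : nat -> R) (l : R) :=
  (fun N => \sum_(1 <= n < N) a n) @ \oo --> l.

Lemma sums_to_lim (R : realType) (a : nat -> R) l :
  sums_to a l -> limn (fun N => \sum_(1 <= n < N) a n) = l.
Proof. exact: cvg_lim. Qed.

Lemma eq_sums_to (R : realType) (a b : nat -> R) l :
  (forall n, (0 < n)%N -> a n = b n) -> sums_to a l -> sums_to b l.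
Proof.
move=> ab; rewrite /sums_to.
suff -> : (fun N => \sum_(1 <= n < N) a n) = (fun N => \sum_(1 <= n < N) b n) by [].
by apply/funext => N; apply: eq_big_nat => n /andP[/ab].
Qed.

Lemma sums_toD (R : realType) (a b : nat -> R) l k :
  sums_to a l -> sums_to b k -> sums_to (fun n => a n + b n) (l + k).
Proof.
move=> al bk; rewrite /sums_to.
under eq_fun do rewrite big_split.
exact: cvgD.
Qed.

Lemma sums_toZ (R : realType) (c : R) (a : nat -> R) l :
  sums_to a l -> sums_to (fun n => c * a n) (c * l).
Proof.
move=> al; rewrite /sums_to.
under eq_fun do rewrite -mulr_sumr.
by apply: cvgM => //; exact: cvg_cst.
Qed.

Lemma sums_to_sum (R : realType) (I : Type) (r : seq I) (P : pred I)
    (a : I -> nat -> R) (l : I -> R) :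
  (forall i, P i -> sums_to (a i) (l i)) ->
  sums_to (fun n => \sum_(i <- r | P i) a i n) (\sum_(i <- r | P i) l i).
Proof.
move=> al; elim: r => [|i r IH].
  apply: (@eq_sums_to _ (fun=> 0)) => [n _|]; first by rewrite big_nil.
  by rewrite /sums_to big_nil; under eq_fun do rewrite big1//; exact: cvg_cst.
rewrite big_cons; case: ifPn => Pi.
  apply: eq_sums_to (sums_toD (al i Pi) IH) => n _.
  by rewrite big_cons Pi.
by apply: eq_sums_to IH => n _; rewrite big_cons (negbTE Pi).
Qed.

Lemma dominated_sums_to (R : realType) (a b : nat -> R) k :
  (forall n, (0 < n)%N -> `|a n| <= b n) -> sums_to b k ->
  exists l, sums_to a l.
Proof.
move=> ab bk.
have shift (c : nat -> R) :
    (fun N => \sum_(1 <= n < N.+1) c n) = series (fun n => c n.+1).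
  by apply/funext => N; rewrite big_add1 /series.
suff /cvg_ex[l al] : cvgn (series (fun n => a n.+1)).
  by exists l; rewrite /sums_to -(cvg_shiftS (fun N => \sum_(1 <= n < N) a n)) shift.
apply: normed_cvg; apply: (@series_le_cvg _ _ (fun n => b n.+1)).
- by move=> n; exact: normr_ge0.
- by move=> n; exact: le_trans (normr_ge0 _) (ab n.+1 _).
- by move=> n; exact: ab.
- apply/cvg_ex; exists k.
  by move: bk; rewrite /sums_to -(cvg_shiftS (fun N => \sum_(1 <= n < N) b n)) shift.
Qed.

(** Multiplied by [(n + 1) ^ b], this is [((n + 1) / n) ^ b >= 1 + b / (n + 1)],
    which follows from [exp u >= 1 + u] and [ln (n / (n + 1)) <= - 1 / (n + 1)].  It makes the
    terms of the p-series telescope. *)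
Lemma powR_decrement (R : realType) (b : R) (n : nat) : 0 < b -> (0 < n)%N ->
  b * (n.+1%:R `^ (1 + b))^-1 <= (n%:R `^ b)^-1 - (n.+1%:R `^ b)^-1.
Proof.
move=> b0 n0.
have n0' : 0 < n%:R :> R by rewrite ltr0n.
have N0' : 0 < n.+1%:R :> R by rewrite ltr0n.
have ln_diff : ln n%:R - ln n.+1%:R <= - n.+1%:R^-1 :> R.
  rewrite -ln_div ?posrE//.
  have -> : n%:R / n.+1%:R = 1 + - n.+1%:R^-1 :> R.
    by rewrite -natr1; field; rewrite natr1 gt_eqF.
  by apply: le_ln1Dx; rewrite ltrN2 invf_lt1// ltr1n.
have key : (n.+1%:R `^ b)^-1 * (1 + b / n.+1%:R) <= (n%:R `^ b)^-1 :> R.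
  rewrite /powR !gt_eqF// -!expRN -ler_pdivlMl ?expR_gt0// -expRN -expRD opprK.
  apply: le_trans (expR_ge1Dx _).
  by rewrite lerD2l -mulrBr ler_pM2l// -[leRHS]opprK opprB lerNr.
rewrite powRD; last by rewrite (gt_eqF N0') implybT.
rewrite powRr1 ?(ltW N0')// lerBrDr (le_trans _ key)// mulrDr mulr1 addrC lerD2l.
by rewrite invfM mulrA mulrC.
Qed.

(** By [powR_decrement] the partial sums stay below [1 + 1 / b]. *)
Lemma p_series_sums_to (R : realType) (b : R) : 0 < b ->
  exists l, sums_to (fun n => (n%:R `^ (1 + b))^-1) l.
Proof.
move=> b0.
suff: cvgn (fun N => \sum_(1 <= n < N.+1) (n%:R `^ (1 + b))^-1 : R).
  move=> /cvg_ex[l al]; exists l.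
  by rewrite /sums_to -(cvg_shiftS (fun N => \sum_(1 <= n < N) (n%:R `^ (1 + b))^-1)).
apply: nondecreasing_is_cvgn.
  apply/nondecreasing_seqP => N.
  by rewrite [leRHS]big_nat_recr//= lerDl invr_ge0 powR_ge0.
exists (1 + b^-1) => _ [N _ <-].
apply: (@le_trans _ _ (1 + b^-1 * (1 - (N.+1%:R `^ b)^-1))); last first.
  by rewrite lerD2l ger_pMr ?invr_gt0// gerBl invr_ge0 powR_ge0.
apply: (@le_trans _ _ (\sum_(1 <= n < N.+2) (n%:R `^ (1 + b))^-1)).
  by rewrite [leRHS]big_nat_recr//= lerDl invr_ge0 powR_ge0.
elim: N => [|N IH].
  by rewrite big_nat1 mulr1n powR1 invr1 subrr mulr0 addr0.
rewrite big_nat_recr//= (le_trans (lerD IH (lexx _)))//.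
rewrite -addrA lerD2l -(ler_pM2l b0) mulrDr !mulrA divff ?gt_eqF// !mul1r -lerBrDl.
by rewrite opprB addrCA [1 - _]addrC addrK powR_decrement.
Qed.

(** * Integration of cosine series *)

Lemma is_derive_big_seq (R : realType) (I : eqType) (r : seq I)
    (F f : I -> R -> R) (x : R) :
  {in r, forall i, is_derive x 1 (F i) (f i x)} ->
  is_derive x 1 (fun y => \sum_(i <- r) F i y) (\sum_(i <- r) f i x).
Proof.
move=> dF; rewrite (_ : (fun y => _) = \sum_(i <- r) F i); last first.
  by apply/funext => y; rewrite fct_sumE.
rewrite [X in is_derive _ _ X]big_seq [X in is_derive _ _ _ X]big_seq.
elim/big_ind2: _ => // [|*]; [exact: is_derive_cst|exact: is_deriveD].
Qed.

Lemma Rintegral_derivative (R : realType) (f F : R -> R) (a b : R) : a <= b ->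
  (forall x : R, is_derive x 1 F (f x)) -> continuous f ->
  \int[lebesgue_measure]_(x in `[a, b]) f x = F b - F a.
Proof.
rewrite le_eqVlt => /predU1P[<- _ _|ab dF cf].
  by rewrite set_itv1 Rintegral_set1 subrr.
have cF : continuous F.
  by move=> x; apply/differentiable_continuous/derivable1_diffP; exact: ex_derive.
rewrite /Rintegral (@continuous_FTC2 _ f F)//.
- exact: continuous_subspaceT.
- split.
  + by move=> x _; exact: ex_derive.
  + by apply: cvg_at_right_filter; exact: cF.
  + by apply: cvg_at_left_filter; exact: cF.
- by move=> x _; rewrite derive1E derive_val.
Qed.

Lemma Rintegral_dominated_cvg (R : realType) (f_ : nat -> R -> R) (f : R -> R)
    (M a b : R) :
  (forall n, continuous (f_ n)) ->
  (forall x, (fun n => f_ n x) @ \oo --> f x) ->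
  (forall n x, `|f_ n x| <= M) ->
  (fun n => \int[lebesgue_measure]_(x in `[a, b]) f_ n x) @ \oo -->
  \int[lebesgue_measure]_(x in `[a, b]) f x.
Proof.
move=> cf f_f f_M.
have f_fE x : (fun n => (f_ n x)%:E) @ \oo --> (f x)%:E.
  by apply: cvg_EFin; [exact: nearW | exact: f_f].
have [] := @dominated_convergence _ _ _ (@lebesgue_measure R) `[a, b]
  (measurable_itv _) (fun n => EFin \o f_ n) (EFin \o f) (cst M%:E).
- move=> n; apply/measurable_EFinP/measurable_funTS.
  by apply: continuous_measurable_fun; exact: cf.
- apply: (emeasurable_fun_cvg (fun n => EFin \o f_ n)) => [n|x _].
    apply/measurable_EFinP/measurable_funTS.
    by apply: continuous_measurable_fun; exact: cf.
  exact: f_fE.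
- by apply: aeW => x _; exact: f_fE.
- apply: (@continuous_compact_integrable _ (cst M)); first exact: segment_compact.
  by apply: continuous_subspaceT => x; exact: cvg_cst.
- by apply: aeW => x n _ /=; rewrite lee_fin; exact: f_M.
move=> intf _ cvgI; apply: fine_cvg => /=.
by rewrite fineK//; exact: integrable_fin_num.
Qed.

Lemma continuous_cos_polynomial (R : realType) (N : nat) (v : nat -> R) (U x : R) :
  continuous (fun e => U - \sum_(1 <= n < N) v n * cos (n%:R * (x + e))).
Proof.
move=> e.
have ds : is_derive e 1 (fun e => \sum_(1 <= n < N) v n * cos (n%:R * (x + e)))
    (\sum_(1 <= n < N) v n * (- sin (n%:R * (x + e)) * n%:R)).
  apply: (@is_derive_big_seq _ _ _ (fun n e => v n * cos (n%:R * (x + e)))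
    (fun n e => v n * (- sin (n%:R * (x + e)) * n%:R))) => n _.
  by apply: is_derive_eq; rewrite add0r /GRing.scale /= mulr1.
apply: cvgB; first exact: cvg_cst.
by apply/differentiable_continuous/derivable1_diffP; exact: ex_derive.
Qed.

(** For each frequency,
    [sin (n (x + b)) - sin (n (x - b)) = 2 cos (n x) sin (n b)]. *)
Lemma Rintegral_cos_polynomial (R : realType) (N : nat) (v : nat -> R)
    (U x b : R) : 0 <= b ->
  \int[lebesgue_measure]_(e in `[- b, b])
    (U - \sum_(1 <= n < N) v n * cos (n%:R * (x + e))) =
  2 * b * U - \sum_(1 <= n < N) v n * (2 * sin (n%:R * b) / n%:R) * cos (n%:R * x).
Proof.
move=> b0.
pose F e := U * e - \sum_(1 <= n < N) v n / n%:R * sin (n%:R * (x + e)).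
transitivity (F b - F (- b)).
  apply: Rintegral_derivative => [|e|e].
  - by rewrite ge0_cp.
  - apply: is_deriveB.
      by apply: is_derive_eq; rewrite scaler1.
    apply: (@is_derive_big_seq _ _ _ (fun n e => v n / n%:R * sin (n%:R * (x + e)))
     (fun n e => v n * cos (n%:R * (x + e)))) => n.
    rewrite mem_index_iota => /andP[n0 _].
    have n0' : n%:R != 0 :> R by rewrite pnatr_eq0 -lt0n.
    by apply: is_derive_eq; rewrite add0r /GRing.scale /=; field.
  - exact: continuous_cos_polynomial.
rewrite /F opprD opprK addrACA [- (\sum_(_ <= _ < _) _) + _]addrC -sumrB; congr (_ + _).
  by ring.
rewrite -[RHS]sumrN; apply: eq_big_nat => n /andP[n0 _].
have n0' : n%:R != 0 :> R by rewrite pnatr_eq0 -lt0n.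
rewrite [n%:R * (x - b)]mulrBr [n%:R * (x + b)]mulrDr sinB sinD.
by field.
Qed.

Definition cos_series (R : realType) (v : nat -> R) (x : R) : R :=
  limn (fun N => \sum_(1 <= n < N) v n * cos (n%:R * x)).

Definition abs_summable (R : realType) (v : nat -> R) :=
  exists k, sums_to (fun n => `|v n|) k.

Lemma cos_series_sums_to (R : realType) (v : nat -> R) (x : R) :
  abs_summable v -> sums_to (fun n => v n * cos (n%:R * x)) (cos_series v x).
Proof.
move=> [k vk].
have [|l vl] := @dominated_sums_to R (fun n => v n * cos (n%:R * x))
  (fun n => `|v n|) k _ vk.
  by move=> n _; rewrite normrM ler_piMr// ler_norml cos_geN1 cos_le1.
by rewrite /cos_series (sums_to_lim vl).
Qed.

(** For [n >= 1] the new factor is at most [2] in absolute value. *)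
Lemma abs_summable_sin (R : realType) (v : nat -> R) (b : R) :
  abs_summable v -> abs_summable (fun n => v n * (2 * sin (n%:R * b) / n%:R)).
Proof.
move=> [k vk].
have := @dominated_sums_to R (fun n => `|v n * (2 * sin (n%:R * b) / n%:R)|)
  (fun n => 2 * `|v n|) (2 * k) _ (sums_toZ (c := 2) vk).
apply=> n n0; rewrite normr_id normrM mulrC ler_wpM2r// normrM.
have n1 : 1 <= n%:R :> R by rewrite ler1n.
rewrite normfV [`|n%:R|]ger0_norm ?(le_trans ler01)//.
rewrite ler_pdivrMr ?(lt_le_trans ltr01)//.
rewrite normrM ger0_norm// ler_pM// (le_trans _ n1)//.
by rewrite ler_norml sin_geN1 sin_le1.
Qed.

(** Functions of the form [U - cos_series v] are stable under integration over
    [[-b, b]]; this is what lets the iterated integral be computed by induction.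
    The partial sums are dominated by the constant [`|U| + sum |v n|], so the
    series may be integrated termwise; for [b < 0] both sides are odd in [b]. *)
Lemma oriented_integral_cos_series (R : realType) (v : nat -> R) (U x b : R) :
  abs_summable v ->
  oriented_integral (- b) b (fun e => U - cos_series v (x + e)) =
  2 * b * U - cos_series (fun n => v n * (2 * sin (n%:R * b) / n%:R)) x.
Proof.
move=> sv.
have nonneg (c : R) : 0 <= c ->
    \int[lebesgue_measure]_(e in `[- c, c]) (U - cos_series v (x + e)) =
    2 * c * U - cos_series (fun n => v n * (2 * sin (n%:R * c) / n%:R)) x.
  move=> c0; have [k vk] := sv.
  pose p N e := U - \sum_(1 <= n < N) v n * cos (n%:R * (x + e)).
  have cvgI : (fun N => \int[lebesgue_measure]_(e in `[- c, c]) p N e) @ \oo -->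
      \int[lebesgue_measure]_(e in `[- c, c]) (U - cos_series v (x + e)).
    apply: (@Rintegral_dominated_cvg _ _ _ (`|U| + k)).
    - by move=> N; exact: continuous_cos_polynomial.
    - by move=> e; apply: cvgB; [exact: cvg_cst|exact: cos_series_sums_to].
    - move=> N e; rewrite (le_trans (ler_normB _ _))// lerD2l.
      rewrite (le_trans (ler_norm_sum _ _ _))//.
      apply: (@le_trans _ _ (\sum_(1 <= n < N) `|v n|)).
        by apply: ler_sum => n _; rewrite normrM ler_piMr// ler_norml cos_geN1 cos_le1.
      move: (vk) => /cvg_lim <-//; apply: nondecreasing_cvgn_le; last first.
        by apply/cvg_ex; exists k.
      apply/nondecreasing_seqP => m.
      case: m => [|m]; first by rewrite !big_geq.
      by rewrite [leRHS]big_nat_recr//= lerDl.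
  move: cvgI; rewrite /p.
  under eq_fun do rewrite Rintegral_cos_polynomial//.
  move=> cvgI; apply: (cvg_unique _ cvgI) => //.
  by apply: cvgB; [exact: cvg_cst|apply: cos_series_sums_to; exact: abs_summable_sin].
rewrite /oriented_integral; have [b0|b0] := leP 0 b.
  by rewrite ge0_cp// nonneg.
rewrite ifF; last by apply/negbTE; rewrite -ltNge (lt_trans b0)// oppr_gt0.
have := nonneg (- b); rewrite opprK => -> ; last by rewrite oppr_ge0 ltW.
rewrite opprB mulrN mulNr opprK addrC; congr (_ + _).
rewrite -[RHS]mulN1r; apply: sums_to_lim.
have := sums_toZ (c := -1) (cos_series_sums_to (x := x) (abs_summable_sin b sv)).
apply: eq_sums_to => n _.
by rewrite mulrN sinN; ring.
Qed.

(** Each integration multiplies the constant by [2 b] and the [n]-th coefficient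
    by [2 sin (n b) / n].  The point [x] stands for the contribution of the
    variables that are not integrated. *)
Lemma iterated_integral_cos_series (R : realType) (bs : seq R) (v : nat -> R)
    (U x : R) : abs_summable v ->
  let w n := v n * \prod_(b <- bs) (2 * sin (n%:R * b) / n%:R) in
  abs_summable w /\
  iterated_integral bs (fun es => U - cos_series v (x + \sum_(e <- es) e)) =
  U * \prod_(b <- bs) (2 * b) - cos_series w x.
Proof.
elim: bs v U => [|b bs IH] v U sv /=.
  have -> : (fun n => v n * \prod_(b <- [::]) (2 * sin (n%:R * b) / n%:R)) = v.
    by apply/funext => n; rewrite big_nil mulr1.
  by rewrite !big_nil addr0 mulr1.
have [sw Ew] := IH _ (2 * b * U) (abs_summable_sin b sv).
have -> : (fun n => v n * \prod_(b <- b :: bs) (2 * sin (n%:R * b) / n%:R)) =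
    (fun n => v n * (2 * sin (n%:R * b) / n%:R) *
      \prod_(b <- bs) (2 * sin (n%:R * b) / n%:R)).
  by apply/funext => n; rewrite big_cons mulrA.
split => //; rewrite big_cons [RHS](_ : _ = 2 * b * U * \prod_(j <- bs) (2 * j) -
  cos_series (fun n => v n * (2 * sin (n%:R * b) / n%:R) *
      \prod_(b <- bs) (2 * sin (n%:R * b) / n%:R)) x); last by congr (_ - _); ring.
rewrite -Ew; congr iterated_integral; apply/funext => es.
rewrite -oriented_integral_cos_series//; congr oriented_integral.
by apply/funext => e; rewrite big_cons addrA addrAC.
Qed.

(** * Cosine sums over products, and Dirichlet kernels *)

(** The sum over [f] of the exponentials [exp (i sum_i x i (f i))] is the product
    of the one-variable sums, and these are real because their sine parts vanish.
    It is used for the points of a cube and for the choices of signs. *)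
Lemma sum_cos_ffun (R : realType) (I J : finType) (Q : pred J) (x : I -> J -> R) :
  (forall i, \sum_(j | Q j) sin (x i j) = 0) ->
  \sum_(f in (ffun_on Q : {pred {ffun I -> J}})) cos (\sum_i x i (f i)) =
  \prod_i \sum_(j | Q j) cos (x i j).
Proof.
move=> odd_x; pose cis (t : R) : R[i] := (cos t +i* sin t)%C.
have cisD : {morph cis : s t / s + t >-> s * t}.
  by move=> s t; rewrite /cis cosD sinD [RHS]/GRing.mul /=; congr (_ +i* _)%C; ring.
have cis0 : cis 0 = 1 by rewrite /cis cos0 sin0.
have cis_sum (t : J -> R) :
    \sum_(j | Q j) cis (t j) =
    ((\sum_(j | Q j) cos (t j)) +i* (\sum_(j | Q j) sin (t j)))%C.
  by elim/big_rec3: _ => // j s c z _ ->.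
transitivity (complex.Re (\sum_(f in (ffun_on Q : {pred {ffun I -> J}}))
    \prod_i cis (x i (f i)))).
  by rewrite raddf_sum; apply: eq_bigr => f _; rewrite -(big_morph cis cisD cis0).
rewrite -(bigA_distr_big Q (fun i j => cis (x i j))).
under eq_bigr do rewrite cis_sum odd_x.
by rewrite -(rmorph_prod (real_complex R)).
Qed.

(** Telescoping, by [2 sin (t / 2) cos a = sin (a + t / 2) - sin (a - t / 2)]. *)
Lemma sum_cos_arith (R : realType) (N : nat) (s t : R) :
  2 * sin (t / 2) * \sum_(k < N) cos (s + k%:R * t) =
  sin (s + N%:R * t - t / 2) - sin (s - t / 2).
Proof.
elim: N => [|N IH]; first by rewrite big_ord0 mul0r addr0 subrr mulr0.
rewrite big_ord_recr/= mulrDr IH -[N.+1%:R]natr1.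
have -> : s + (N%:R + 1) * t - t / 2 = (s + N%:R * t) + t / 2 by field.
by rewrite [sin (_ + t / 2)]sinD [sin (s + N%:R * t - t / 2)]sinB; ring.
Qed.

(** The index [k] in [0, ..., 2 n] encodes the frequency [k - n]. *)
Lemma Dirichlet_kernel (R : realType) (n : nat) (t : R) : sin (t / 2) != 0 ->
  \sum_(k < n.*2.+1) cos ((k%:R - n%:R) * t) =
  sin (n%:R * t) * cot (t / 2) + cos (n%:R * t).
Proof.
move=> t0; have := sum_cos_arith n.*2.+1 (- (n%:R * t)) t.
under eq_bigr do rewrite -mulNr -mulrDl addrC.
rewrite -[n.*2.+1%:R]natr1 -addnn natrD.
have -> : - (n%:R * t) + (n%:R + n%:R + 1) * t - t / 2 = n%:R * t + t / 2 by field.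
rewrite -opprD sinN opprK sinD => /(canRL (mulKf _)) ->; last by rewrite mulf_neq0.
by rewrite /cot; field.
Qed.

(** The reflection [k -> 2 n - k] changes the sign of every term. *)
Lemma sum_odd_ord (R : realType) (n : nat) (Q : pred 'I_(n.*2.+1)) (t : R) :
  (forall k, Q (rev_ord k) = Q k) ->
  \sum_(k | Q k) sin ((k%:R - n%:R) * t) = 0.
Proof.
move=> Qrev; apply/eqP; rewrite -[_ == 0](mulrn_eq0 _ 2) mulr2n -[X in _ + X]opprK.
rewrite subr_eq0 -sumrN [X in X == _](reindex_inj rev_ord_inj)/= (eq_bigl Q)//.
apply/eqP; apply: eq_bigr => k _; rewrite -sinN -mulNr; congr (sin (_ * _)).
have kn : (k <= n.*2)%N by rewrite -ltnS.
have n2 : n.*2%:R = n%:R + n%:R :> R by rewrite -addnn natrD.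
by rewrite subSS natrB// n2 opprB addrAC addrK.
Qed.

(** Subtracting [floor (x / pi)] times [pi] leaves a zero of [sin] in [[0, pi)],
    where [sin y = 2 sin (y / 2) cos (y / 2)] vanishes only at [0]. *)
Lemma sin_eq0_int (R : realType) (x : R) : sin x = 0 -> exists k : int, x = pi * k%:~R.
Proof.
move=> sx0; have pi0 := pi_gt0 R.
have sin_nat n : sin (pi * n%:R) = 0 :> R.
  by rewrite mulr_natr -[_ *+ n]add0r (alternatingn (@sinDpi R)) sin0 mulr0.
have sin_int (k : int) : sin (pi * k%:~R) = 0 :> R.
  by case: k => n; rewrite ?NegzE ?mulrNz ?mulrN ?sinN sin_nat ?oppr0.
exists (Num.floor (x / pi)); set k := Num.floor _.
have [k_le lt_k] : pi * k%:~R <= x /\ x < pi * k%:~R + pi.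
  have /andP[] := floor_itv (x / pi); rewrite -/k ler_pdivlMr// ltr_pdivrMr//.
  by rewrite rmorphD mulrDl mul1r [_ * pi]mulrC.
have : sin (x - pi * k%:~R) = 0 by rewrite sinB sx0 sin_int mul0r mulr0 subr0.
set y := x - _; have y_lt : y < pi by rewrite ltrBlDl.
move: k_le; rewrite -subr_ge0 -/y le_eqVlt => /predU1P[/esym/subr0_eq//|y0].
have -> : y = y / 2 + y / 2 by rewrite -splitr.
have : 0 < sin (y / 2) by apply: sin_gt0_pihalf; apply/andP; split; lra.
have : 0 < cos (y / 2) by apply: cos_gt0_pihalf; apply/andP; split; lra.
by rewrite sinD => c s; nra.
Qed.

(** * Subsets of the indices and the sequences in [Jset] *)

Lemma size_enum_setC (d : nat) (A : {set 'I_d}) :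
  size (enum A ++ enum (~: A)) == d.
Proof. by rewrite size_cat -!cardE cardsC card_ord. Qed.

(** The sequence of [Jset #|A|] whose first [#|A|] entries form [A]. *)
Definition split_tuple (d : nat) (A : {set 'I_d}) : d.-tuple 'I_d :=
  Tuple (size_enum_setC A).

Lemma sorted_val_eq (d : nat) (s t : seq 'I_d) :
  sorted leq [seq val i | i <- s] -> sorted leq [seq val i | i <- t] ->
  perm_eq s t -> s = t.
Proof.
move=> ss st pst; apply: (inj_map val_inj); apply: (sorted_eq leq_trans anti_leq ss st).
exact: perm_map.
Qed.

Lemma sorted_enum_ord (d : nat) (A : {set 'I_d}) :
  sorted leq [seq val i | i <- enum A].
Proof.
rewrite sorted_map /enum_mem; apply: sorted_filter.
  by move=> i j k; apply: leq_trans.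
by rewrite -enumT -sorted_map val_enum_ord iota_sorted.
Qed.

(** An increasing sequence is determined by the set of its entries, so [j] is
    determined by the set of its first [m] entries; the condition on the right
    has the form needed to reindex a sum along [split_tuple]. *)
Lemma JsetP (d : nat) (m : 'I_d.+1) (j : d.-tuple 'I_d) :
  Jset m j = (#|[set i in take m j]| == m) && (split_tuple [set i in take m j] == j).
Proof.
have sz : size (take m j) = m by rewrite size_takel// size_tuple -ltnS.
apply/idP/idP => [/and3P[uj st sd]|/andP[/eqP cA /eqP jE]].
  have ut : uniq (take m j) by rewrite take_uniq.
  have -> : #|[set i in take m j]| = m by rewrite cardsE (card_uniqP ut).
  rewrite eqxx /=; apply/eqP/val_inj => /=.
  have /fintype.subsetP jT : predT \subset (j : seq 'I_d).
    rewrite -(subset_leqif_card (subset_predT (mem (j : seq 'I_d)))).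
    by rewrite (card_uniqP uj) size_tuple card_ord.
  rewrite -[RHS](cat_take_drop m); congr cat; apply: sorted_val_eq => //;
    try exact: sorted_enum_ord; apply: uniq_perm; rewrite ?enum_uniq ?drop_uniq// => i.
    by rewrite mem_enum inE.
  rewrite mem_enum !inE.
  have : i \in take m j ++ drop m j by rewrite cat_take_drop jT.
  have : uniq (take m j ++ drop m j) by rewrite cat_take_drop.
  rewrite cat_uniq mem_cat => /and3P[_ /hasPn dis _].
  case: (boolP (i \in take m j)) => /= [it _|_ ->//].
  by apply/esym/negbTE/negP => /dis/negP; apply.
have take_j : take m j = enum [set i in take m j].
  by rewrite -{1}jE take_cat -cardE cA ltnn subnn take0 cats0.
have drop_j : drop m j = enum (~: [set i in take m j]).
  by rewrite -{1}jE drop_cat -cardE cA ltnn subnn drop0.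
apply/and3P; split; [|by rewrite take_j sorted_enum_ord|
  by rewrite drop_j sorted_enum_ord].
rewrite -(cat_take_drop m j) take_j drop_j cat_uniq !enum_uniq andbT /=.
by apply/hasPn => i; rewrite !mem_enum inE.
Qed.

Lemma prod_take_Jset (R : realType) (d : nat) (m : 'I_d.+1) (j : d.-tuple 'I_d)
    (x y : 'I_d -> R) : Jset m j ->
  \prod_(i <- take m j) x i * \prod_(i <- drop m j) y i =
  \prod_i (if i \in [set i in take m j] then x i else y i).
Proof.
rewrite JsetP => /andP[/eqP cA /eqP jE]; set A := [set i in take m j] in cA jE *.
have -> : take m j = enum A by rewrite -{1}jE take_cat -cardE cA ltnn subnn take0 cats0.
have -> : drop m j = enum (~: A) by rewrite -{1}jE drop_cat -cardE cA ltnn subnn drop0.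
rewrite !big_enum/= (bigID (mem A) predT)/=; congr (_ * _).
  by apply: eq_bigr => i ->.
by apply: eq_big => i; rewrite !inE// => /negbTE ->.
Qed.

Lemma sum_Jset (R : realType) (d : nat) (P : pred nat) (x y : 'I_d -> R) :
  \sum_(m < d.+1 | P m) \sum_(j : d.-tuple 'I_d | Jset m j)
    \prod_(i <- take m j) x i * \prod_(i <- drop m j) y i =
  \sum_(A : {set 'I_d} | P #|A|) \prod_i (if i \in A then x i else y i).
Proof.
have cardA (A : {set 'I_d}) : (#|A| < d.+1)%N.
  by rewrite ltnS -[leqRHS](card_ord d) max_card.
rewrite [RHS](partition_big (fun A => Ordinal (cardA A)) P)//=.
apply: eq_bigr => m Pm.
transitivity (\sum_(A : {set 'I_d} | #|A| == m)
    \prod_i (if i \in A then x i else y i)); last first.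
  apply: eq_bigl => A; rewrite -val_eqE /=.
  by case: eqP => [->|_]; rewrite ?andbF ?andbT.
rewrite (reindex_onto (fun j : d.-tuple 'I_d => [set i in take m j])
  (@split_tuple d))/=; last first.
  move=> A /eqP cA; apply/finset.setP => i.
  by rewrite inE /= take_cat -cardE cA ltnn subnn take0 cats0 mem_enum.
apply: eq_big => j; first by rewrite JsetP.
exact: prod_take_Jset.
Qed.

(** Expand both products over the set [A] of the indices where [x] is chosen:
    [A] contributes with the weight [1 - (-1) ^ #|A|]. *)
Lemma prodD_sub_prodB (R : realType) (d : nat) (x y : 'I_d -> R) :
  \prod_i (y i + x i) - \prod_i (y i - x i) =
  2 * \sum_(m < d.+1 | odd m) \sum_(j : d.-tuple 'I_d | Jset m j)
    \prod_(i <- take m j) x i * \prod_(i <- drop m j) y i.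
Proof.
under eq_bigr do rewrite addrC.
under [X in _ - X]eq_bigr do rewrite addrC.
rewrite sum_Jset !bigA_distr -sumrB mulr_sumr [RHS]big_mkcond/=.
apply: eq_bigr => A _.
have -> : \prod_i (if i \in A then - x i else y i) =
    (-1) ^+ #|A| * \prod_i (if i \in A then x i else y i).
  rewrite -prodr_const [X in X * _]big_mkcond -big_split; apply: eq_bigr => i _ /=.
  by case: ifP => _; rewrite ?mulN1r ?mul1r.
by rewrite -signr_odd; case: odd; rewrite /= ?expr1 ?expr0; ring.
Qed.

(** * Lattice points of given max-norm *)

Definition int_norm (d : nat) (z : 'rV[int]_d) : nat := \max_(i < d) `|z ord0 i|%N.

Lemma norm_intr_row (R : realType) (d : nat) (z : 'rV[int]_d) :
  `|map_mx intr z : 'rV[R]_d| = (int_norm z)%:R.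
Proof.
rewrite /Num.norm/= mx_normrE; apply/eqP; rewrite eq_le; apply/andP; split.
  apply/bigmax_leP; split => // -[i j] _ /=; rewrite mxE ord1 -intr_norm -abszE ler_nat.
  exact: (leq_bigmax j).
rewrite /int_norm; elim/big_ind: _ => [|p q|j _].
- exact: bigmax_ge_id.
- by rewrite /maxn; case: ifP.
rewrite (_ : `|z ord0 j|%N%:R = `|(map_mx intr z : 'rV[R]_d) 0 j| :> R).
  exact: (le_bigmax _ (fun ij => `|map_mx intr z ij.1 ij.2| : R) (0, j)).
by rewrite mxE -intr_norm -abszE.
Qed.

(** The condition [z != 0] only matters for [n = 0], where it leaves nothing. *)
Definition shell (d n : nat) : set 'rV[int]_d :=
  [set z | z != 0 /\ int_norm z = n]%classic.

Definition cube_row (d n : nat) (f : {ffun 'I_d -> 'I_(n.*2.+1)}) : 'rV[int]_d :=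
  \row_i ((f i)%:Z - n%:Z).

Lemma cube_row_inj (d n : nat) : injective (@cube_row d n).
Proof.
move=> f g fg; apply/ffunP => i; apply/val_inj.
by move: (congr1 (fun z : 'rV[int]_d => z 0 i) fg); rewrite !mxE => /addIr[].
Qed.

(** The ordinal [k] encodes the coordinate [k - n]. *)
Definition cube_interior (n : nat) : pred 'I_(n.*2.+1) := fun k => (0 < k < n.*2)%N.

Lemma cube_interiorE (n : nat) (k : 'I_(n.*2.+1)) :
  cube_interior k = (`|k%:Z - n%:Z| < n)%N.
Proof. by rewrite /cube_interior; case: k => k /= kn; lia. Qed.

Lemma int_norm_cube_row (d n : nat) (f : {ffun 'I_d -> 'I_(n.*2.+1)}) : (0 < n)%N ->
  (int_norm (cube_row f) == n) = (f \notin ffun_on (@cube_interior n)).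
Proof.
move=> n0.
have le_n : (int_norm (cube_row f) <= n)%N.
  by apply/bigmax_leqP => i _; rewrite mxE; case: (f i) => k /= kn; lia.
rewrite eqn_leq le_n /= leqNgt; congr (~~ _).
apply/idP/ffun_onP => [lt_n i|fi].
  rewrite /in_mem /= cube_interiorE (leq_ltn_trans _ lt_n)//.
  by have := leq_bigmax (F := fun i => `|cube_row f ord0 i|%N) i; rewrite mxE.
rewrite -[n in (_ < n)%N]prednK// ltnS; apply/bigmax_leqP => i _.
by have := fi i; rewrite /in_mem /= cube_interiorE mxE; case: n n0 f {fi le_n}.
Qed.

Lemma shellE (d n : nat) : (0 < n)%N ->
  @shell d n = [set` [seq cube_row f |
    f <- enum [pred f : {ffun 'I_d -> 'I_(n.*2.+1)} |
               f \notin ffun_on (@cube_interior n)]]]%classic.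
Proof.
move=> n0; apply/seteqP; split=> z /=.
  move=> [z0 zn].
  have lt_n i : (`|(z ord0 i + n%:Z)%R| < n.*2.+1)%N.
    have := leq_bigmax (F := fun i => `|z ord0 i|%N) i; rewrite -/(int_norm z) zn.
    lia.
  pose f := [ffun i => Ordinal (lt_n i)].
  have zE : z = cube_row f.
    apply/rowP => i; rewrite mxE ffunE /=.
    have := leq_bigmax (F := fun i => `|z ord0 i|%N) i; rewrite -/(int_norm z) zn /=.
    have -> : z 0 i = z ord0 i by [].
    move: (z ord0 i) => k; lia.
  apply/mapP; exists f => //; rewrite mem_enum inE -int_norm_cube_row//.
  by rewrite -zE zn.
move=> /mapP[f]; rewrite mem_enum inE -int_norm_cube_row// => /eqP fn ->.
split=> //; apply: contraTneq n0 => f0.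
by rewrite -fn f0 /int_norm big1// => i _; rewrite mxE.
Qed.

Lemma esum_shell (R : realType) (d n : nat) (a : 'rV[int]_d -> R) :
  (0 < n)%N -> (forall z, 0 <= a z) ->
  \esum_(z in @shell d n) (a z)%:E =
  (\sum_(f : {ffun 'I_d -> 'I_(n.*2.+1)} | f \notin ffun_on (@cube_interior n))
     a (cube_row f))%:E.
Proof.
move=> n0 a0; rewrite shellE// esum_fset; [|exact: finite_seq|
  by move=> z _; rewrite lee_fin].
rewrite -fsbig_seq ?map_inj_uniq ?enum_uniq//; last exact: cube_row_inj.
rewrite big_map big_enum_cond /= sumEFin; congr (_%:E); apply: eq_bigl => f.
by rewrite andbT.
Qed.

(** The sum over the cube minus the sum over its interior; dropping the two
    extreme frequencies turns the kernel [s + cos] into [s - cos].  The kernel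
    is left abstract because the value [s = 2 n] at [t = 0], where the sum counts
    points, is not given by the formula with the cotangent. *)
Lemma sum_cos_shell (R : realType) (d n : nat) (t s : 'I_d -> R) : (0 < n)%N ->
  (forall i, \sum_(k < n.*2.+1) cos ((k%:R - n%:R) * t i) = s i + cos (n%:R * t i)) ->
  \sum_(f : {ffun 'I_d -> 'I_(n.*2.+1)} | f \notin ffun_on (@cube_interior n))
    cos (\sum_i (cube_row f 0 i)%:~R * t i) =
  2 * \sum_(m < d.+1 | odd m) \sum_(j : d.-tuple 'I_d | Jset m j)
    \prod_(i <- take m j) cos (n%:R * t i) * \prod_(i <- drop m j) s i.
Proof.
move=> n0 kernel.
pose x i (k : 'I_(n.*2.+1)) : R := (k%:R - n%:R) * t i.
have xE f i : (cube_row f 0 i)%:~R * t i = x i (f i) by rewrite mxE rmorphB.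
under eq_bigr do under eq_bigr do rewrite xE.
have n2 : (0 < n.*2)%N by rewrite double_gt0.
have interior i : \sum_(k | cube_interior k) cos (x i k) = s i - cos (n%:R * t i).
  have := kernel i; rewrite (bigD1 ord0)//= (bigD1 ord_max)/=; last first.
    by rewrite -val_eqE /= -lt0n.
  have -> : cos ((0 - n%:R) * t i) = cos (n%:R * t i) by rewrite sub0r mulNr cosN.
  have -> : (n.*2%:R - n%:R) * t i = n%:R * t i by rewrite -addnn natrD addrK.
  rewrite (eq_bigl (@cube_interior n)); last first.
    by move=> k; rewrite -!val_eqE /= /cube_interior lt0n ltn_neqAle -ltnS ltn_ord andbT.
  by rewrite -/(x i) => /(canRL (addKr _)) /(canRL (addKr _)) ->; ring.
have box (Q : pred 'I_(n.*2.+1)) : (forall k, Q (rev_ord k) = Q k) ->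
    \sum_(f in (ffun_on Q : {pred {ffun 'I_d -> 'I_(n.*2.+1)}}))
      cos (\sum_i x i (f i)) =
    \prod_i \sum_(k | Q k) cos (x i k).
  by move=> Qrev; apply: sum_cos_ffun => i; exact: sum_odd_ord.
have : \sum_(f : {ffun 'I_d -> 'I_(n.*2.+1)}) cos (\sum_i x i (f i)) =
    \prod_i (s i + cos (n%:R * t i)).
  rewrite -(eq_bigr _ (fun i _ => kernel i)) -box//; apply: eq_bigl => f.
  by apply/esym/ffun_onP.
rewrite (bigID (mem (ffun_on (@cube_interior n))))/= box; last first.
  by move=> k; rewrite /cube_interior; case: k => k /= kn; lia.
under [X in (X + _ = _) -> _]eq_bigr do rewrite interior.
by rewrite -prodD_sub_prodB => /(canRL (addKr _)) ->; rewrite addrC.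
Qed.

Lemma sum_shell (R : realType) (d n : nat) (t : 'I_d -> R) : (0 < n)%N ->
  (forall i, sin (t i / 2) != 0) ->
  \sum_(f : {ffun 'I_d -> 'I_(n.*2.+1)} | f \notin ffun_on (@cube_interior n))
    (1 - cos (\sum_i (cube_row f 0 i)%:~R * t i)) =
  \sum_(m < d.+1 | odd m) \sum_(j : d.-tuple 'I_d | Jset m j)
    2 * ((2 * n%:R) ^+ (d - m) -
      \prod_(i <- take m j) cos (n%:R * t i) *
      \prod_(i <- drop m j) (sin (n%:R * t i) * cot (t i / 2))).
Proof.
move=> n0 t0.
have card_shell :
    \sum_(f : {ffun 'I_d -> 'I_(n.*2.+1)} | f \notin ffun_on (@cube_interior n))
      (1 : R) =
    2 * \sum_(m < d.+1 | odd m) \sum_(j : d.-tuple 'I_d | Jset m j)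
      \prod_(i <- take m j) cos (n%:R * 0) * \prod_(i <- drop m j) (2 * n%:R).
  rewrite -(@sum_cos_shell _ _ _ (fun=> 0) (fun=> 2 * n%:R))//.
    by apply: eq_bigr => f _; rewrite big1 ?cos0// => i _; rewrite mulr0.
  move=> _; under eq_bigr do rewrite mulr0 cos0.
  by rewrite sumr_const card_ord mulr0 cos0 -[LHS]natr1 -muln2 natrM mulrC.
rewrite sumrB card_shell.
rewrite (@sum_cos_shell _ _ _ t
  (fun i => sin (n%:R * t i) * cot (t i / 2)))//; last first.
  by move=> i; exact: Dirichlet_kernel.
rewrite -mulrBr -sumrB mulr_sumr; apply: eq_bigr => m _.
rewrite -sumrB mulr_sumr; apply: eq_bigr => j _; congr (2 * (_ - _)).
under eq_bigr do rewrite mulr0 cos0.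
by rewrite big1_eq mul1r big_const_seq count_predT size_drop size_tuple iter_mulr_1.
Qed.

(** * The contribution of each sequence in [Jset] *)

Lemma H_eq_zeta_sub_cos_series (R : realType) (s : R) : 1 < s ->
  let v n := (n%:R `^ s)^-1 in
  [/\ abs_summable v, sums_to v (zeta s)
    & forall t, H (s - 1) t = zeta s - cos_series v t].
Proof.
move=> s1 v; have [|l] := @p_series_sums_to R (s - 1); first by rewrite subr_gt0.
have -> : 1 + (s - 1) = s by rewrite addrC subrK.
rewrite -/v => vl.
have sv : abs_summable v.
  by exists l; apply: eq_sums_to vl => n _; rewrite ger0_norm// invr_ge0 powR_ge0.
have vz : sums_to v (zeta s).
  rewrite /zeta (_ : limn _ = l)//; apply: sums_to_lim.
  by apply: eq_sums_to vl => n _; rewrite powRN.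
split=> // t; apply: sums_to_lim.
have -> : 1 + (s - 1) = s by rewrite addrC subrK.
have := sums_toD vz (sums_toZ (c := -1) (cos_series_sums_to (x := t) sv)).
by rewrite mulN1r; apply: eq_sums_to => n _; rewrite mulrBr mulr1 mulN1r.
Qed.

Lemma sum_cos_signed (R : realType) (d : nat) (theta : 'rV[R]_d) (m : 'I_d.+1)
    (j : d.-tuple 'I_d) (c : R) :
  \sum_(s : {ffun 'I_m -> bool}) cos (c * signed_sum theta j s) =
  2 ^+ m * \prod_(i <- take m j) cos (c * theta 0 i).
Proof.
pose x (k : 'I_m) (b : bool) :=
  c * ((-1) ^+ b * theta 0 (tnth j (widen_ord (leq_ord m) k))).
have -> : \sum_(s : {ffun 'I_m -> bool}) cos (c * signed_sum theta j s) =
    \sum_(s in (ffun_on predT : {pred {ffun 'I_m -> bool}})) cos (\sum_k x k (s k)).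
  apply: eq_big => s; first by apply/esym/ffun_onP.
  by rewrite /signed_sum mulr_sumr.
rewrite sum_cos_ffun => [|k]; last first.
  by rewrite big_bool /x /= expr0 expr1 mul1r mulN1r mulrN sinN addNr.
transitivity (\prod_(k < m) (2 * cos (c * theta 0 (tnth j (widen_ord (leq_ord m) k))))).
  apply: eq_bigr => k _.
  by rewrite big_bool /x /= expr0 expr1 mul1r mulN1r mulrN cosN; ring.
rewrite big_split /= prodr_const card_ord; congr (_ * _).
have -> : take m j = [seq tnth j (widen_ord (leq_ord m) k) | k <- enum 'I_m].
  have sz : size (take m j) = m by rewrite size_takel// size_tuple -ltnS.
  case E : (take m j) => [|i0 r].
    by have /size0nil -> : size (enum 'I_m) = 0%N by rewrite size_enum_ord -[LHS]sz E.
  rewrite -E; apply: (@eq_from_nth _ i0) => [|i].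
    by rewrite size_map size_enum_ord.
  rewrite sz => im.
  rewrite (nth_map (Ordinal im)) ?size_enum_ord// nth_take//.
  by rewrite (tnth_nth i0) /= nth_enum_ord.
by rewrite big_map big_enum.
Qed.

(** The summand is the part of the sum over the sphere of radius [n] that belongs
    to [(m, j)].  In the value of the series, the products of the [theta_i] coming
    from the zeta term and from the constant part of the iterated integral cancel. *)
Lemma Jset_term_sums_to (R : realType) (d : nat) (alpha : R) (theta : 'rV[R]_d)
    (m : 'I_d.+1) (j : d.-tuple 'I_d) : 0 < alpha -> (0 < m)%N ->
  sums_to (fun n => (n%:R `^ (d%:R + alpha))^-1 * (2 * ((2 * n%:R) ^+ (d - m) -
      \prod_(i <- take m j) cos (n%:R * theta 0 i) *
      \prod_(i <- drop m j) (sin (n%:R * theta 0 i) * cot (theta 0 i / 2)))))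
    (2 * (zeta (m%:R + alpha)
          * (2 ^+ (d - m)
             - \prod_(i <- drop m j) (theta 0 i * cot (theta 0 i / 2))))
     + (2 ^+ (d - 1))^-1 * ((\prod_(i <- drop m j) cot (theta 0 i / 2))
          * \sum_(s : {ffun 'I_m -> bool})
              iterated_integral [seq theta 0 i | i <- drop m j]
                (fun es => H (m%:R + alpha - 1)
                             (signed_sum theta j s + \sum_(e <- es) e)))).
Proof.
move=> alpha0 m0.
have md : (m <= d)%N by rewrite -ltnS.
have s1 : 1 < m%:R + alpha by apply: (@le_lt_trans _ _ m%:R); rewrite ?ler1n ?ltrDl.
have [sv vz HE] := H_eq_zeta_sub_cos_series s1.
set z := zeta (m%:R + alpha) in vz HE *.
set v := (fun n => _) in sv vz HE.
set bs := [seq theta 0 i | i <- drop m j].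
(* Only the summability of the new coefficients is taken here, hence the
   arbitrary point 0. *)
have [su _] := iterated_integral_cos_series bs z 0 sv.
set u := (fun n => _) in su.
have uE n : u n = v n * \prod_(i <- drop m j) (2 * sin (n%:R * theta 0 i) / n%:R).
  by rewrite /u /bs big_map.
have intE s : iterated_integral bs (fun es => H (m%:R + alpha - 1)
      (signed_sum theta j s + \sum_(e <- es) e)) =
    z * \prod_(i <- drop m j) (2 * theta 0 i) - cos_series u (signed_sum theta j s).
  under eq_fun do rewrite HE.
  have [_ ->] := iterated_integral_cos_series bs z (signed_sum theta j s) sv.
  by rewrite /bs big_map.
under [X in _ + _ * (_ * X)]eq_bigr do rewrite intE.
set Pcot := \prod_(i <- drop m j) cot (theta 0 i / 2).
have sum_cos :
    sums_to (fun n => 2 ^+ m * u n * \prod_(i <- take m j) cos (n%:R * theta 0 i))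
    (\sum_(s : {ffun 'I_m -> bool}) cos_series u (signed_sum theta j s)).
  have := @sums_to_sum R _ (index_enum {ffun 'I_m -> bool}) predT _ _
    (fun s _ => cos_series_sums_to (x := signed_sum theta j s) su).
  apply: eq_sums_to => n _.
  by rewrite -mulr_sumr sum_cos_signed; ring.
have := sums_toD (sums_toZ (c := 2 * 2 ^+ (d - m)) vz)
  (sums_toZ (c := - ((2 ^+ (d - 1))^-1 * Pcot)) sum_cos).
have pow2 : 2 ^+ d = 2 * 2 ^+ (d - 1) :> R.
  by rewrite -exprS -subSn ?subSS ?subn0// (leq_trans m0).
have pow2m : 2 ^+ m * 2 ^+ (d - m) = 2 ^+ d :> R by rewrite -exprD subnKC.
have size_drop_m : size (drop m j) = (d - m)%N by rewrite size_drop size_tuple.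
have prod_const (c : R) : \prod_(i <- drop m j) c = c ^+ (d - m).
  by rewrite big_const_seq count_predT size_drop_m iter_mulr_1.
rewrite sumrB sumr_const card_ffun card_bool card_ord -[z * _ *+ _]mulr_natr natrX.
rewrite [\prod_(i <- drop m j) (2 * _)]big_split /= prod_const.
rewrite [\prod_(i <- drop m j) (theta 0 i * _)]big_split /= -/Pcot.
set Pth := \prod_(i <- drop m j) theta 0 i.
set S := \sum_(s : {ffun 'I_m -> bool}) _.
have p0 : 2 ^+ (d - 1) != 0 :> R by rewrite expf_neq0.
have -> : 2 * 2 ^+ (d - m) * z + - ((2 ^+ (d - 1))^-1 * Pcot) * S =
  2 * (z * (2 ^+ (d - m) - Pth * Pcot)) +
  (2 ^+ (d - 1))^-1 * (Pcot * (z * (2 ^+ (d - m) * Pth) * 2 ^+ m - S)).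
  have -> : z * (2 ^+ (d - m) * Pth) * 2 ^+ m = z * Pth * (2 * 2 ^+ (d - 1)).
    by rewrite -pow2 -pow2m; ring.
  by field.
apply: eq_sums_to => n n0.
have n0' : n%:R != 0 :> R by rewrite pnatr_eq0 -lt0n.
rewrite big_split /= -/Pcot uE.
rewrite [\prod_(i <- drop m j) (2 * _ / _)]big_split /= prod_const.
rewrite big_split /= prod_const.
have -> : (n%:R `^ (d%:R + alpha))^-1 = v n * (n%:R ^+ (d - m))^-1.
  rewrite /v -invfM -powR_mulrn// -powRD ?(negbTE n0') ?implybT//; congr (_ `^ _)^-1.
  by rewrite natrB//; ring.
rewrite exprMn exprVn.
set Ps := \prod_(i <- drop m j) _; set Pc := \prod_(i <- take m j) _.
have q0 : n%:R ^+ (d - m) != 0 :> R by rewrite expf_neq0.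
set q := n%:R ^+ (d - m) in q0 *.
have -> : - ((2 ^+ (d - 1))^-1 * Pcot) *
    (2 ^+ m * (v n * (2 ^+ (d - m) * Ps * q^-1)) * Pc) =
  - ((2 ^+ (d - 1))^-1 * Pcot) * ((2 * 2 ^+ (d - 1)) * (v n * (Ps * q^-1)) * Pc).
  by rewrite -pow2 -pow2m; ring.
by field; rewrite q0 p0.
Qed.

(** * Summation over the spheres *)

(** The terms being nonnegative, they may be grouped by spheres. *)
Lemma esum_by_shells (R : realType) (d : nat) (a : 'rV[int]_d -> R)
    (b : nat -> R) (l : R) :
  (forall z, 0 <= a z) ->
  (forall n, (0 < n)%N ->
    \sum_(f : {ffun 'I_d -> 'I_(n.*2.+1)} | f \notin ffun_on (@cube_interior n))
      a (cube_row f) = b n) ->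
  sums_to b l ->
  \esum_(z in [set z : 'rV[int]_d | z != 0]%classic) (a z)%:E = l%:E.
Proof.
move=> a0 ab bl.
have -> : [set z : 'rV[int]_d | z != 0]%classic = \bigcup_n @shell d n.
  by apply/seteqP; split=> [z z0|z [n _ []]//]; exists (int_norm z).
rewrite nneseries_sum_bigcup; first last.
- by move=> z; rewrite lee_fin.
- by move=> p q _ _ [z [[_ <-] [_ <-]]].
have shell0 : @shell d 0 = set0.
  apply/seteqP; split=> // z [z0 zn]; case/negP: z0; apply/eqP/rowP => i.
  have := leq_bigmax (F := fun i => `|z ord0 i|%N) i; rewrite -/(int_norm z) zn mxE.
  by rewrite leqn0 absz_eq0 => /eqP.
have sumE : (fun N => \sum_(0 <= n < N) \esum_(z in @shell d n) (a z)%:E)%E =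
    (fun N => (\sum_(1 <= n < N) b n)%:E).
  apply/funext => -[|N]; first by rewrite !big_geq.
  rewrite big_ltn// shell0 esum_set0 add0e -sumEFin.
  by apply: eq_big_nat => n /andP[n0 _]; rewrite esum_shell// ab.
rewrite sumE; apply: cvg_lim => //.
by apply: cvg_EFin; [exact: nearW|exact: bl].
Qed.

Theorem theorem1 (R : realType) (d : nat) (alpha : R) (theta : 'rV[R]_d)
    (hd : (2 <= d)%N) (halpha : 0 < alpha)
    (htheta : forall (i : 'I_d) (k : int), theta 0 i <> 2 * pi * k%:~R) :
  Fsum alpha theta =
  (2 * (\sum_(m < d.+1 | odd m) \sum_(j : d.-tuple 'I_d | Jset m j)
          zeta (m%:R + alpha)
          * (2 ^+ (d - m)
             - \prod_(i <- drop m j) (theta 0 i * cot (theta 0 i / 2))))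
   + (2 ^+ (d - 1))^-1
     * (\sum_(m < d.+1 | odd m) \sum_(j : d.-tuple 'I_d | Jset m j)
          (\prod_(i <- drop m j) cot (theta 0 i / 2))
          * \sum_(s : {ffun 'I_m -> bool})
              iterated_integral [seq theta 0 i | i <- drop m j]
                (fun es => H (m%:R + alpha - 1)
                             (signed_sum theta j s + \sum_(e <- es) e))))%:E.
Proof.
have sin_half i : sin (theta 0 i / 2) != 0.
  apply/eqP => /sin_eq0_int[k theta_k]; apply: (htheta i k).
  by rewrite -mulrA -theta_k; field.
have rhs :=
  @sums_to_sum R _ (index_enum _) _ _ _ (fun (m : 'I_d.+1) (modd : odd m) =>
    @sums_to_sum R _ (index_enum _) _ _ _ (fun (j : d.-tuple 'I_d) (_ : Jset m j) =>
      @Jset_term_sums_to R d alpha theta m j halpha (odd_gt0 modd))).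
rewrite !mulr_sumr -big_split /=.
under eq_bigr do rewrite !mulr_sumr -big_split /=.
apply: esum_by_shells rhs => [z|n n0].
  by rewrite mulr_ge0 ?invr_ge0 ?powR_ge0// subr_ge0 cos_le1.
transitivity ((n%:R `^ (d%:R + alpha))^-1 *
    \sum_(f : {ffun 'I_d -> 'I_(n.*2.+1)} | f \notin ffun_on (@cube_interior n))
    (1 - cos (\sum_i (cube_row f 0 i)%:~R * theta 0 i))).
  rewrite mulr_sumr; apply: eq_bigr => f fn.
  rewrite norm_intr_row; congr ((_%:R `^ _)^-1 * _).
  by apply/eqP; rewrite int_norm_cube_row.
rewrite (sum_shell n0 sin_half) mulr_sumr; apply: eq_bigr => m _.
by rewrite mulr_sumr.
Qed.
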